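(* Let $s\in\mathbb{N}_0$, $h\in\mathbb{C}\setminus\{0\}$, and $p,q\in\mathbb{C}$ with $p\neq 1\neq q$. Then for all $m\in\mathbb{N}$ and $0\le k\le\ell\le m$ the normal ordering coefficient $\mathcal{J}_{s,p,q}(m,\ell,k)$ is given by $$\mathcal{J}_{s,p,q}(m,\ell,k)=\sum_{\lambda\in\mathcal{I}_{m-\ell,\ell}}\mathscr{R}_{s,1;p,q}[B_\lambda,k].$$ In particular, for $X,Y,Z_p$ satisfying the commutation relations of $A_{s;h|p,q}$, $$(X+Y)^m=\sum_{\ell=0}^m\sum_{k=0}^{\ell}\sum_{\lambda\in\mathcal{I}_{m-\ell,\ell}}h^k\,\mathscr{R}_{s,1;p,q}[B_\lambda,k]\,Y^{m-\ell+(s-1)k}Z_p^kX^{\ell-k}.$$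
   Context: $\mathbb{N}_0=\{0,1,2,\dots\}$. The algebra $A_{s;h|p,q}$ is the complex unital associative algebra generated by $X,Y,Z_p$ with relations $XY-qYX=hY^sZ_p$, $Z_pY=pYZ_p$, $XZ_p=pZ_pX$, and $Z_1=I$ (i.e. $Z_p$ is the identity when $p=1$). $\mathcal{I}_{a,b}$ is the set of integer sequences $\lambda=(\lambda_1,\dots,\lambda_b)$ with $a\ge\lambda_1\ge\cdots\ge\lambda_b\ge0$. $B_\lambda$ is the Ferrers board whose columns, from left to right, are aligned at the top and have $\lambda_1,\dots,\lambda_b$ boxes. Normal ordering coefficients: $\mathcal{J}_{s,p,q}(m,0,k)=1$ and, for $\ell\ne0$, $$\mathcal{J}_{s,p,q}(m,\ell,k)=\sum_{\mathbf{k}\in\{0,1\}^\ell,\,|\mathbf{k}|=k}\ \sum_{\lambda\in\mathcal{I}_{m-\ell,\ell}}p^{\sum_{j=1}^{\ell-1}(1-k_{j+1})\sum_{l=1}^{j}k_l}\;q^{\sum_{j=1}^{\ell}(1-k_j)a_j}\prod_{j=1}^{\ell}[a_j]_{p,q}^{k_j},$$ where $a_j=\lambda_{\ell-j+1}+(s-1)\sum_{l=1}^{j-1}k_l$ and $[n]_{p,q}=\sum_{i=1}^np^{n-i}q^{i-1}=\frac{p^n-q^n}{p-q}$. Here $0^0=1$, and a summand containing a factor $[0]_{p,q}$ is taken to be $0$ (which covers all cases, possible only for $s=0$, where some $a_j<0$). Case $s>0$: a placement $\phi\in\mathcal{R}_s(B,k)$ of $k$ rooks satisfying the $s$-row creation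 rule is obtained by placing $k$ rooks on $B$ from right to left, at most one per column; whenever a rook is placed in a row, that row is replaced, in all columns to the left of the rook, by $s+1$ rows, the top one being the row of the rook just placed and the $s$ rows beneath it being new rows; a later rook may not be placed in the row of an earlier rook. Boxes are those of the resulting subdivided board and are classified as: a rook box (occupied by a rook); a $t$-box (not a rook box, lying above a rook and not lying to the left of another rook); an $\ell$-box (not a rook box, lying to the left of a rook and not in the column of another rook); a cancelled box (not a rook box, lying to the left of a rook and in the column of another rook); an $e$-box (any remaining box). Then $\mathscr{R}_{s,h;p,q}[B,k]=h^k\sum_{\phi\in\mathcal{R}_s(B,k)}p^{\#t\text{-boxes}+\#\ell\text{-boxes}}q^{\#e\text{-boxes}}$. Case $s=0$: $\mathscr{R}_{0,1;p,q}[B,k]:=\sum_{\phi}p^{\#p\text{-boxes}}q^{\#q\text{-boxes}}$, the sum running over all placements $\phi$ of $k$ non-attacking rooks (no two in the same row or column) on $B$, where a $p$-box is a box not occupied by a rook, lying above or to the left of a rook, and neither lying to the left of another rook nor in the column of another rook; a cancelled box is a box not occupied by a rook, lying above or to the left of a rook, that is not a $p$-box; a $q$-box is any remaining box not occupied by a rook. Terms of the expansion with coefficient $0$ are omitted even if the formal exponent of $Y$ is negative. *)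

(* Defs.v *)
From HB Require Import structures.
From mathcomp Require Import all_boot all_order all_algebra.
From mathcomp Require Import reals.
From mathcomp.real_closed Require Export complex.
Set Implicit Arguments.
Unset Strict Implicit.
Unset Printing Implicit Defensive.
Import GRing.Theory.
Local Open Scope ring_scope.

(* The relations of A_{s;h|p,q}; [Z] is the generator Z_p. *)
Definition pq_relations (K : fieldType) (s : nat) (h p q : K)
    (A : algType K) (X Y Z : A) : Prop :=
  [/\ X * Y - q *: (Y * X) = h *: (Y ^+ s * Z),
      Z * Y = p *: (Y * Z),
      X * Z = p *: (Z * X)
    & p = 1 -> Z = 1].

(* I_{a,b}; the entry lambda_i is [lam] at the 0-based index i - 1. *)
Definition Iab (a b : nat) : {set {ffun 'I_b -> 'I_a.+1}} :=
  [set lam : {ffun 'I_b -> 'I_a.+1} | [forall i : 'I_b, forall j : 'I_b,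
     (i <= j)%N ==> (lam j <= lam i)%N]].

Definition pqnum (K : fieldType) (p q : K) (n : nat) : K :=
  \sum_(1 <= i < n.+1) p ^+ (n - i) * q ^+ i.-1.

Section NormalOrderingCoefficient.
Variables (K : fieldType) (s : nat) (p q : K) (a l : nat).
Implicit Types (k : {ffun 'I_l -> bool}) (lam : {ffun 'I_l -> 'I_a.+1}).

Definition before k (j : 'I_l) : nat := (\sum_(i < l | (i < j)%N) k i)%N.

(* [rev_ord j] is the index of lambda_{l-j+1}. *)
Definition jexp k lam (j : 'I_l) : int :=
  Posz (lam (rev_ord j)) + (s%:Z - 1) * Posz (before k j).

(* A summand with a factor [0]_{p,q} is 0.  In every other summand all the
   exponents a_j are nonnegative, so [absz] does not alter them.  In the
   exponent of [p], the index j + 1 of the usual formula is called [j]; the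
   additional first term has an empty inner sum. *)
Definition jterm k lam : K :=
  if [exists j, k j && (jexp k lam j == 0)] then 0 else
    p ^+ (\sum_(j < l) (1 - k j) * before k j)%N *
    q ^ (\sum_(j < l) (1 - (k j)%:Z) * jexp k lam j) *
    \prod_(j < l) pqnum p q `|jexp k lam j|%N ^+ k j.

End NormalOrderingCoefficient.

Definition jcoef (K : fieldType) (s : nat) (p q : K) (m l k : nat) : K :=
  if l == 0%N then 1 else
    \sum_(kk : {ffun 'I_l -> bool} | (\sum_(j < l) kk j == k)%N)
      \sum_(lam in Iab (m - l) l) jterm s p q kk lam.

(* A board is a set of boxes (c, r): columns are numbered from left to right,
   rows from top to bottom. *)
Definition ferrers (a b : nat) (lam : {ffun 'I_b -> 'I_a.+1}) :
    {set 'I_b * 'I_a} :=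
  [set x : 'I_b * 'I_a | (x.2 < lam x.1)%N].

(* Rook placements with the s-row creation rule (s > 0).  A row of a
   subdivided board is labelled by a word: [:: r] is row r of the original
   board, and subdividing row w gives, from top to bottom, the rows
   w, w1, ..., ws.  Two boxes of different columns lie in the same row iff
   their row labels are equal. *)
Definition row_label : Type := seq nat.

Definition columns (a b : nat) (B : {set 'I_b * 'I_a}) :
    seq (seq row_label) :=
  [seq [seq [:: val r] | r <- enum 'I_a & (c, r) \in B] | c <- rev (enum 'I_b)].

Definition subdivide (s : nat) (w : row_label) (col : seq row_label) :
    seq row_label :=
  flatten [seq if x == w then w :: [seq rcons w i | i <- iota 1 s] else [:: x]
          | x <- col].

(* Columns are listed from right to left, each by its rows from top to bottom;
   the second component of an item is the row of the rook of the column. *)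
Definition rooked_board : Type := seq (seq row_label * option row_label).

(* All ways of placing rooks from right to left on the columns [cols]; no
   placement is listed twice.  [used] lists the rows of the rooks already
   placed to the right, the latest first; these rows are subdivided in the
   order of placement. *)
Fixpoint placements (s : nat) (used : seq row_label)
    (cols : seq (seq row_label)) : seq rooked_board :=
  if cols is col0 :: cols' then
    let col := foldr (subdivide s) col0 used in
    [seq (col, None) :: phi | phi <- placements s used cols'] ++
    [seq (col, Some x) :: phi | x <- [seq x <- col | x \notin used],
       phi <- placements s (x :: used) cols']
  else [:: [::]].

Section Boxes.
Variable phi : rooked_board.
(* A box is a pair (column index from the right, row); a rook is identified
   with the index of its column. *)
Implicit Types (x : nat * row_label) (i : 'I_(size phi)).

Definition rook_of (c : nat) : option row_label := (nth ([::], None) phi c).2.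

Definition nrooks : nat := count (fun cr => isSome cr.2) phi.

Definition boxes : seq (nat * row_label) :=
  [seq (c, w) | c <- iota 0 (size phi), w <- (nth ([::], None) phi c).1].

Definition rook_box x : bool := rook_of x.1 == Some x.2.
Definition left_of x i : bool := (i < x.1)%N && (rook_of i == Some x.2).
Definition above x i : bool :=
  (x.1 == i) &&
  (if rook_of i is Some w then
     let col := (nth ([::], None) phi i).1 in (index x.2 col < index w col)%N
   else false).
Definition in_column x i : bool := (x.1 == i) && isSome (rook_of i).

Definition tbox x : bool :=
  ~~ rook_box x &&
  [exists i, above x i && [forall j, (j != i) ==> ~~ left_of x j]].
Definition lbox x : bool :=
  ~~ rook_box x &&
  [exists i, left_of x i && [forall j, (j != i) ==> ~~ in_column x j]].
Definition cancelled_box x : bool :=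
  ~~ rook_box x &&
  [exists i, left_of x i && [exists j, (j != i) && in_column x j]].
Definition ebox x : bool :=
  ~~ [|| rook_box x, tbox x, lbox x | cancelled_box x].

End Boxes.

Definition rook_pos (K : fieldType) (s : nat) (h p q : K) (a b : nat)
    (B : {set 'I_b * 'I_a}) (k : nat) : K :=
  h ^+ k * \sum_(phi <- placements s [::] (columns B) | nrooks phi == k)
    p ^+ (count (tbox phi) (boxes phi) + count (lbox phi) (boxes phi)) *
    q ^+ count (ebox phi) (boxes phi).

Section NonAttacking.
Variables (a b : nat) (B phi : {set 'I_b * 'I_a}).
Implicit Types x y z : 'I_b * 'I_a.

Definition nonattacking : bool :=
  [forall x in phi, forall y in phi,
     (x != y) ==> (x.1 != y.1) && (x.2 != y.2)].

Definition cell_left x y : bool := (x.1 < y.1)%N && (x.2 == y.2).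
Definition cell_above x y : bool := (x.1 == y.1) && (x.2 < y.2)%N.

Definition pbox0 x : bool :=
  [&& x \in B, x \notin phi &
    [exists y in phi, (cell_above x y || cell_left x y) &&
      [forall z in phi, (z != y) ==> ~~ cell_left x z && (x.1 != z.1)]]].
Definition cancelled_box0 x : bool :=
  [&& x \in B, x \notin phi,
    [exists y in phi, cell_above x y || cell_left x y] & ~~ pbox0 x].
Definition qbox0 x : bool :=
  [&& x \in B, x \notin phi, ~~ pbox0 x & ~~ cancelled_box0 x].

End NonAttacking.

Definition rook_zero (K : fieldType) (p q : K) (a b : nat)
    (B : {set 'I_b * 'I_a}) (k : nat) : K :=
  \sum_(phi : {set 'I_b * 'I_a} |
        [&& phi \subset B, nonattacking phi & #|phi| == k])
    p ^+ #|[set x | pbox0 B phi x]| * q ^+ #|[set x | qbox0 B phi x]|.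

(* The rook number R_{s,1;p,q}[B,k]. *)
Definition rook1 (K : fieldType) (s : nat) (p q : K) (a b : nat)
    (B : {set 'I_b * 'I_a}) (k : nat) : K :=
  if s == 0%N then rook_zero p q B k else rook_pos s 1 p q B k.

(* Hence the truncated exponent m - l + s k - k of Y in the expansion of
   (X + Y)^m only occurs truncated in terms with coefficient 0. *)
Lemma rook1_eq0 (K : fieldType) (s : nat) (p q : K) (a b : nat)
    (B : {set 'I_b * 'I_a}) (k : nat) :
  (a + s * k < k)%N -> rook1 s p q B k = 0.
Proof.
case: s => [|s]; last by rewrite mulSn addnCA ltnNge leq_addr.
rewrite mul0n addn0 /rook1 eqxx => ltak; apply: big1 => phi.
case/and3P=> _ /forallP na /eqP cphi; exfalso.
have inj : {in phi &, injective (fun x : 'I_b * 'I_a => x.2)}.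
  move=> x y xin yin exy; apply/eqP/negPn/negP => nxy.
  have /implyP/(_ xin)/forallP/(_ y)/implyP/(_ yin)/implyP/(_ nxy) := na x.
  by case/andP=> _; rewrite exy eqxx.
have := max_card [in [set x.2 | x in phi]].
by rewrite (card_in_imset inj) card_ord cphi leqNgt ltak.
Qed.

(* Main.v *)
Require Import Defs.
From mathcomp Require Import all_boot all_order all_algebra.
From mathcomp Require Import reals.
From mathcomp.real_closed Require Import complex.
From mathcomp Require Import zify ring.
Import GRing.Theory.
Local Open Scope ring_scope.
Set Implicit Arguments.
Unset Strict Implicit.
Unset Printing Implicit Defensive.

(* Everything is compared with one weight [wt lam k], defined by recursion on
   the leftmost column of the board.  A column of height c with k rooks to its
   right has k boxes lying to the left of these rooks and n = c + (s - 1) k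
   available boxes, whatever the rooks are: it contributes p^k q^n if it stays
   empty, and [n]_{p,q} = \sum_i p^(i-1) q^(n-i) if it receives a rook, the
   i-th available box being the i-th summand.  The same two factors appear in
     X Y^n Z^k = q^n p^k Y^n Z^k X + h [n]_{p,q} Y^(n+s-1) Z^(k+1),
   so the weights are also the coefficients obtained by normally ordering,
   letter by letter from the right, the word in X and Y whose i-th X has
   lambda_i letters Y to its right. *)

(** * Column weights and the coefficients J *)

Section FfunExtend.
Variables (T : finType) (n : nat) (h : 'I_n.+1).

Definition ffext (f : {ffun 'I_n -> T}) (x : T) : {ffun 'I_n.+1 -> T} :=
  [ffun i => oapp f x (unlift h i)].

Lemma ffext_lift f x j : ffext f x (lift h j) = f j.
Proof. by rewrite ffunE liftK. Qed.

Lemma ffext_self f x : ffext f x h = x.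
Proof. by rewrite ffunE unlift_none. Qed.

(** Extension is a bijection, so sums over functions admit induction on the number of arguments:
    [sum_bits] splits off the last one, [sum_rowswt] the first. *)
Lemma big_ffext (V : nmodType) (P : pred {ffun 'I_n.+1 -> T}) F :
  \sum_(g : {ffun 'I_n.+1 -> T} | P g) F g =
  \sum_(f : {ffun 'I_n -> T}) \sum_(x | P (ffext f x)) F (ffext f x) :> V.
Proof.
rewrite (pair_big_dep xpredT (fun f x => P (ffext f x)) (fun f x =>
  F (ffext f x))) /=.
rewrite (reindex (fun u : {ffun 'I_n -> T} * T => ffext u.1 u.2)) //=.
exists (fun g : {ffun 'I_n.+1 -> T} => ([ffun j => g (lift h j)], g h)).
  case=> f x _ /=; rewrite ffext_self; congr (_, _).
  by apply/ffunP => j; rewrite ffunE ffext_lift.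
move=> g _; apply/ffunP => i /=; rewrite ffunE.
by case: unliftP => [j|] -> //=; rewrite ffunE.
Qed.

End FfunExtend.

Section Weights.
Variables (K : fieldType) (s : nat) (p q : K).

Lemma pqnum0 : pqnum p q 0 = 0.
Proof. by rewrite /pqnum big_geq. Qed.

(** This is a column growing at its top: each rook gains a box above it, hence p, and a rook in the
    new box has n boxes of weight q below it. *)
Lemma pqnumS n : pqnum p q n.+1 = p * pqnum p q n + q ^+ n.
Proof.
rewrite /pqnum big_nat_recr //= subnn expr0 mul1r; congr (_ + _).
rewrite mulr_sumr; apply: eq_big_nat => i /andP[_ ltin].
by rewrite subSn // exprS mulrA.
Qed.

(* Truncates only for s = 0 and k > c; its occurrences are then multiplied by 0,
   see [wt_gt_avail]. *)
Definition avail (c k : nat) : nat := (c + s * k - k)%N.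

Definition step (w : nat -> K) (c k : nat) : K :=
  p ^+ k * q ^+ avail c k * w k +
  (if k is k'.+1 then pqnum p q (avail c k') * w k' else 0).

Fixpoint wt (lam : seq nat) : nat -> K :=
  if lam is c :: lam' then step (wt lam') c else fun k => (k == 0)%:R.

Lemma wt_gt_size lam k : (size lam < k)%N -> wt lam k = 0.
Proof.
elim: lam k => [|c lam IH] [|k] //= ltk; rewrite /step !IH ?mulr0 ?addr0 //.
by rewrite ltnS ltnW.
Qed.

(** The bound on k forces s = 0, where at most c rooks fit into c rows. The case not settled by
    induction is a rook in a column without free rows; it has the factor [0]. *)
Lemma wt_gt_avail lam c k : path geq c lam -> (c + s * k < k)%N -> wt lam k = 0.
Proof.
elim: lam c k => [|c' lam IH] c [|k] //= /andP[le_c' slam] ltk.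
rewrite /step (IH _ _ slam) ?mulr0 ?add0r; last first.
  by move: le_c' ltk; rewrite /=; lia.
have [ltc'|] := ltnP (c' + s * k) k; first by rewrite (IH c') ?mulr0.
move: le_c' ltk; rewrite /avail /= => le_c' ltk lec'.
suff -> : (c' + s * k - k = 0)%N by rewrite pqnum0 mul0r.
have s0 : s = 0%N by move: ltk; case: (s) => // s'; rewrite mulSn; lia.
by move: ltk lec'; rewrite s0; lia.
Qed.

(* The weight [wt] read from the rightmost column on, with b rooks already placed:
   this is the order of the recursion in [placements]. *)
Fixpoint fwd (b : nat) (cs : seq nat) (k : nat) : K :=
  if cs is c :: cs' then
    p ^+ b * q ^+ avail c b * fwd b cs' k +
    (if k is k'.+1 then pqnum p q (avail c b) * fwd b.+1 cs' k' else 0)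
  else (k == 0)%:R.

(** The appended column is the leftmost one, so the b earlier rooks and all rooks in [cs] lie to its
    right. *)
Lemma fwd_rcons b cs c k :
  fwd b (rcons cs c) k =
  p ^+ (b + k) * q ^+ avail c (b + k) * fwd b cs k +
  (if k is k'.+1 then pqnum p q (avail c (b + k')) * fwd b cs k' else 0).
Proof.
elim: cs b k => [|c' cs IH] b [|k] /=; rewrite ?addn0 ?mulr0 ?add0r ?addr0 //.
- by case: k => [|k] /=; rewrite ?addn0 ?mulr0.
- by rewrite IH addn0 addr0 mulrCA.
rewrite !IH; case: k => [|k].
  by rewrite !addn0 addn1; ring.
by rewrite !addSnnS; ring.
Qed.

Lemma wt_fwd lam k : wt lam k = fwd 0 (rev lam) k.
Proof.
elim: lam k => [|c lam IH] k //=; rewrite rev_cons fwd_rcons /step !add0n IH.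
by case: k => [|k] //; rewrite IH.
Qed.

(** The part of [jterm] belonging to one index j: p^b q^n if k_j = 0 and [n] if k_j = 1, which are
    the two factors in [step]. *)
Definition bitterm (c b : nat) (k : bool) : K :=
  p ^+ ((1 - k) * b) * q ^+ ((1 - k) * avail c b) * pqnum p q (avail c b) ^+ k.

(** The bits tell which columns receive a rook. The largest j belongs to the leftmost column; all
    other bits count in its [before], as all other columns lie to its right. *)
Lemma sum_bits l (g : 'I_l -> nat) k :
  \sum_(kk : {ffun 'I_l -> bool} | (\sum_(j < l) kk j == k)%N)
     \prod_(j < l) bitterm (g j) (before kk j) (kk j) =
  wt (rev [seq g j | j <- enum 'I_l]) k.
Proof.
elim: l g k => [|l IH] g k.
  rewrite enum_ord0 /=.
  rewrite (eq_bigl (fun=> k == 0%N)); last first.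
    by move=> kk; rewrite big_ord0 eq_sym.
  case: (k =P 0%N) => _ /=; last by rewrite big_pred0.
  rewrite (eq_bigr (fun=> 1)); last by move=> kk; rewrite big_ord0.
  by rewrite sumr_const card_ffun card_ord expn0.
rewrite (big_ffext ord_max) enum_ordSr map_rcons rev_rcons -map_comp /=.
pose g' j := g (widen_ord (leqnSn l) j).
have widl j : widen_ord (leqnSn l) j = lift ord_max j.
  by apply: val_inj; rewrite /= /bump leqNgt ltn_ord.
have sumE (f : {ffun 'I_l -> bool}) x :
    (\sum_(j < l.+1) (ffext ord_max f x) j = \sum_(j < l) f j + x)%N.
  rewrite big_ord_recr /= ffext_self; congr (_ + _)%N; apply: eq_bigr => j _.
  by rewrite widl ffext_lift.
have befE (f : {ffun 'I_l -> bool}) x j :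
    before (ffext ord_max f x) (lift ord_max j) = before f j.
  rewrite /before big_mkcond big_ord_recr lift_max ltnNge [(j <= _)%N]ltnW //=
    addn0.
  by rewrite [RHS]big_mkcond; apply: eq_bigr => i _ /=; rewrite widl ffext_lift.
have befM (f : {ffun 'I_l -> bool}) x :
    before (ffext ord_max f x) ord_max = (\sum_(j < l) f j)%N.
  rewrite /before big_mkcond big_ord_recr /= ltnn addn0.
  by apply: eq_bigr => j _; rewrite widl ffext_lift /= ltn_ord.
have prodE (f : {ffun 'I_l -> bool}) x :
    \prod_(j < l.+1)
       bitterm (g j) (before (ffext ord_max f x) j) (ffext ord_max f x j) =
    bitterm (g ord_max) (\sum_(j < l) f j) x *
    \prod_(j < l) bitterm (g' j) (before f j) (f j).
  rewrite big_ord_recr /= mulrC befM ffext_self; congr (_ * _).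
  by apply: eq_bigr => j _; rewrite /g' !widl befE ffext_lift.
(* The values 1 and 0 of the last bit yield the second and the first summand of [step]. *)
under eq_bigr => f _.
  rewrite big_mkcond big_bool /= !sumE !prodE addn0 addn1.
  over.
rewrite big_split /= addrC; rewrite /step; congr (_ + _).
  rewrite -big_mkcond -IH mulr_sumr; apply: eq_bigr => f /eqP ->.
  by rewrite /bitterm subn0 !mul1n expr0 mulr1.
case: k => [|k]; first by rewrite big1.
rewrite -big_mkcond -IH mulr_sumr /=; apply: eq_bigr => f.
by rewrite eqSS => /eqP ->; rewrite /bitterm subnn !mul0n !expr0 !mul1r expr1.
Qed.

(** Only s = 0 needs an argument. There a_j starts nonnegative and drops by at most one from j to j
    + 1, since lambda_(l-j+1) does not decrease as j grows; it drops only if k_j = 1, and then a_j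
    is nonzero by hypothesis. *)
Lemma jexp_ge0 a l (kk : {ffun 'I_l -> bool}) (lam : {ffun 'I_l -> 'I_a.+1}) :
  lam \in Iab a l -> ~~ [exists j, kk j && (jexp s kk lam j == 0)] ->
  forall j, (before kk j <= lam (rev_ord j) + s * before kk j)%N.
Proof.
rewrite inE => /forallP mon /existsPn nz.
case: s nz => [|s'] nz; last by move=> j; rewrite mulSn; lia.
have {}nz j : kk j -> (before kk j != lam (rev_ord j))%N.
  move=> kj; have := nz j; rewrite kj /jexp /=; lia.
case=> j; elim: j => [|j IH] ltj.
  by rewrite /before big_pred0.
have ltj' := ltnW ltj.
have := IH ltj'; set j0 := Ordinal ltj'; set j1 := Ordinal ltj.
have -> : before kk j1 = (before kk j0 + kk j0)%N.
  rewrite /before (bigD1 j0) //= addnC; congr (_ + _)%N.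
  by apply: eq_bigl => i; rewrite ltnS -(inj_eq val_inj) /=; lia.
have le_lam : (lam (rev_ord j0) <= lam (rev_ord j1))%N.
  have /forallP/(_ (rev_ord j0)) := mon (rev_ord j1).
  by move/implyP; apply => /=; lia.
have := nz j0; case: (kk j0); lia.
Qed.

(** If some factor is [0], the corresponding [avail] is 0 and the product vanishes as well.
    Otherwise [jexp_ge0] makes every truncated difference [avail] equal to a_j. *)
Lemma jtermE a l (kk : {ffun 'I_l -> bool}) (lam : {ffun 'I_l -> 'I_a.+1}) :
  lam \in Iab a l ->
  jterm s p q kk lam =
  \prod_(j < l) bitterm (lam (rev_ord j)) (before kk j) (kk j).
Proof.
move=> lamI; rewrite /jterm; case: ifPn => [/existsP[j /andP[kj /eqP ej]]|nz].
  rewrite (bigD1 j) //= /bitterm kj.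
  suff -> : avail (lam (rev_ord j)) (before kk j) = 0%N by rewrite pqnum0 expr1
    mulr0 mul0r.
  by move: ej; rewrite /jexp /avail; lia.
have ge0 := jexp_ge0 lamI nz.
have jE j : jexp s kk lam j = avail (lam (rev_ord j)) (before kk j).
  have := ge0 j; rewrite /jexp /avail => ge; rewrite -subzn // PoszD PoszM;
      ring.
have -> : \sum_(j < l) (1 - (kk j)%:Z) * jexp s kk lam j =
   Posz (\sum_(j < l) (1 - kk j) * avail (lam (rev_ord j)) (before kk j))%N.
  rewrite (big_morph Posz PoszD (erefl _)); apply: eq_bigr => j _.
  by rewrite jE; case: (kk j); lia.
by rewrite -exprnP !expr_sum -!big_split; apply: eq_bigr => j _; rewrite jE.
Qed.

End Weights.

(** * Normal ordering of (X + Y)^m *)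

Definition heights (a b : nat) (lam : {ffun 'I_b -> 'I_a.+1}) : seq nat :=
  [seq val (lam i) | i <- enum 'I_b].

Lemma size_heights a b (lam : {ffun 'I_b -> 'I_a.+1}) : size (heights lam) = b.
Proof. by rewrite size_map size_enum_ord. Qed.

Lemma nth_heights a b (lam : {ffun 'I_b -> 'I_a.+1}) (i : 'I_b) :
  nth 0%N (heights lam) i = lam i.
Proof. by rewrite (nth_map i) ?size_enum_ord // nth_ord_enum. Qed.

Lemma path_heights a b (lam : {ffun 'I_b -> 'I_a.+1}) :
  (lam \in Iab a b) = path geq a (heights lam).
Proof.
rewrite path_sortedE; last by move=> x y z /=; lia.
have -> /= : all (geq a) (heights lam).
  by apply/allP => _ /mapP[i _ ->] /=; rewrite -ltnS ltn_ord.
rewrite inE; apply/forallP/idP => [mon|srt i].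
  have geq_tr : transitive geq by move=> x y z /=; lia.
  rewrite (sorted_pairwise geq_tr); apply/(pairwiseP 0%N) => i j.
  rewrite !inE size_heights => lti ltj ltij.
  rewrite (nth_heights lam (Ordinal lti)) (nth_heights lam (Ordinal ltj)) /=.
  by have /forallP/(_ (Ordinal ltj))/implyP := mon (Ordinal lti); apply;
    apply: ltnW.
apply/forallP => j; apply/implyP => leij; rewrite -!nth_heights.
apply: (sorted_leq_nth (leT := geq)) => //; rewrite ?inE ?size_heights //.
  by move=> x y z /=; lia.
by move=> x /=.
Qed.

(** The elements of I_{a,b} as lists: lambda_1 = c is chosen first and bounds the rest. This matches
    the recursion of [word] and [wt] on the leading entry. *)
Fixpoint parts (b a : nat) : seq (seq nat) :=
  if b is b'.+1 then [seq c :: l | c <- iota 0 a.+1, l <- parts b' c]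
  else [:: [::]].

Lemma partsS b a :
  parts b.+1 a = [seq c :: l | c <- iota 0 a.+1, l <- parts b c].
Proof. by []. Qed.

Lemma mem_parts b a l : (l \in parts b a) = (size l == b) && path geq a l.
Proof.
elim: b a l => [|b IH] a l; first by case: l.
rewrite partsS; apply/allpairsPdep/andP => [[c [l' [c_in l'_in ->]]]|].
  move: c_in l'_in; rewrite mem_iota IH /= => lec /andP[/eqP -> ->].
  by rewrite eqxx andbT; split=> //; lia.
case: l => [[]//|c l] [szl /andP[lec pl]].
exists c, l; rewrite mem_iota IH; split=> //.
by apply/andP.
Qed.

Lemma parts_uniq b a : uniq (parts b a).
Proof.
elim: b a => [|b IH] a //; apply: allpairs_uniq_dep; first exact: iota_uniq.
  by move=> c _; apply: IH.
by case=> c1 l1 [c2 l2] _ _ /= [-> ->].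
Qed.

Lemma big_parts (V : nmodType) a b (F : seq nat -> V) :
  \sum_(lam in Iab a b) F (heights lam) = \sum_(l <- parts b a) F l.
Proof.
rewrite -big_enum -(big_map (@heights a b) xpredT F); apply: perm_big.
have hinj : injective (@heights a b).
  move=> lam1 lam2 e; apply/ffunP => i; apply: val_inj.
  by rewrite /= -!nth_heights e.
apply: uniq_perm; rewrite ?parts_uniq ?map_inj_uniq ?enum_uniq // => l.
rewrite mem_parts; apply/mapP/andP => [[lam + ->]|[/eqP szl pl]].
  by rewrite mem_enum path_heights size_heights eqxx.
have eql : heights [ffun i : 'I_b => inord (nth 0%N l i) : 'I_a.+1] = l.
  apply: (@eq_from_nth _ 0%N); rewrite size_heights // => i lti.
  rewrite (nth_heights _ (Ordinal lti)) ffunE inordK // ltnS /=.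
  have /allP/(_ (nth 0%N l i)) : all (geq a) l.
    by apply: order_path_min pl => x y z /=; lia.
  by apply; rewrite mem_nth ?szl.
exists [ffun i : 'I_b => inord (nth 0%N l i) : 'I_a.+1]; last by rewrite eql.
by rewrite mem_enum path_heights eql.
Qed.

Section Words.
Variables (K : fieldType) (A : algType K) (X Y : A).

(* The product whose lambda_i is the number of [Y] to the right of
   the i-th [X] from the left. *)
Fixpoint word (a : nat) (lam : seq nat) : A :=
  if lam is c :: lam' then Y ^+ (a - c) * X * word c lam' else Y ^+ a.

(** All words with a letters Y and b letters X, each of them once. *)
Definition words (a b : nat) : A := \sum_(l <- parts b a) word a l.

Lemma words0r a : words a 0 = Y ^+ a.
Proof. by rewrite /words big_seq1. Qed.

Lemma wordsSr a b :
  words a b.+1 = \sum_(c < a.+1) Y ^+ (a - c) * X * words c b.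
Proof.
rewrite /words partsS big_allpairs_dep -[iota 0 a.+1]/(index_iota 0 a.+1)
  big_mkord.
by apply: eq_bigr => c _; rewrite mulr_sumr.
Qed.

Lemma words0l b : words 0 b = X ^+ b.
Proof.
elim: b => [|b IH]; first by rewrite words0r.
by rewrite wordsSr big_ord1 /= IH mul1r exprS.
Qed.

(** Sorting by the first letter: the summand c = a + 1 has no Y before its first X, all others begin
    with Y. *)
Lemma wordsSS a b : words a.+1 b.+1 = Y * words a b.+1 + X * words a.+1 b.
Proof.
rewrite !wordsSr big_ord_recr /= subnn mul1r; congr (_ + _).
rewrite mulr_sumr; apply: eq_bigr => c _.
by rewrite subSn ?exprS ?mulrA // -ltnS ltn_ord.
Qed.

Lemma exprDwords m : (X + Y) ^+ m = \sum_(0 <= l < m.+1) words (m - l) l.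
Proof.
elim: m => [|m IH]; first by rewrite big_nat1 words0r.
(* The pure powers of X and Y are split off, because [wordsSS] concerns words containing both
   letters. *)
rewrite [LHS]exprS IH mulrDl !mulr_sumr [RHS]big_nat_recl // subn0 words0r.
rewrite [in RHS]big_nat_recr //= subnn words0l.
rewrite (big_nat_recr m) //= subnn words0l.
rewrite [X in _ + X]big_nat_recl // subn0 words0r.
rewrite -!exprS [LHS]addrC -addrA; congr (_ + _); rewrite addrA; congr (_ + _).
rewrite -big_split; apply: eq_big_nat => l /= ltl.
by rewrite (subSn ltl) wordsSS -(subSn ltl) subSS.
Qed.

End Words.

Section NormalOrder.
Variables (K : fieldType) (s : nat) (h p q : K) (A : algType K) (X Y Z : A).
Hypothesis XYZ : pq_relations s h p q X Y Z.

Lemma mulXY : X * Y = q *: (Y * X) + h *: (Y ^+ s * Z).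
Proof. by case: XYZ => <- *; rewrite addrC subrK. Qed.

Lemma mulZY : Z * Y = p *: (Y * Z).
Proof. by case: XYZ. Qed.

Lemma mulXZ : X * Z = p *: (Z * X).
Proof. by case: XYZ. Qed.

Lemma mulXZn n : X * Z ^+ n = p ^+ n *: (Z ^+ n * X).
Proof.
elim: n => [|n IH]; first by rewrite mulr1 mul1r scale1r.
rewrite [in LHS]exprSr mulrA IH -scalerAl -mulrA.
by rewrite mulXZ -scalerAr scalerA mulrA -!exprSr.
Qed.

(** When X reaches the last Y, a new Z arises with coefficient h q^n; a Z created earlier passes
    this Y with a factor p. Together this is [pqnumS]. *)
Lemma mulXYn n :
  X * Y ^+ n = q ^+ n *: (Y ^+ n * X) +
               (h * pqnum p q n) *: (Y ^+ (n + s).-1 * Z).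
Proof.
elim: n => [|n IH]; first by rewrite pqnum0 mulr0 scale0r addr0 scale1r mulr1
  mul1r.
rewrite [in LHS]exprSr mulrA IH mulrDl -!scalerAl -!mulrA mulXY mulZY.
rewrite mulrDr -!scalerAr scalerDr !scalerA.
rewrite !mulrA -!exprSr -exprD -addrA addSn /=; congr (_ + _).
(* The predecessor truncates only if n = s = 0, and for n = 0 the coefficient is 0. *)
have -> : (h * pqnum p q n * p) *: (Y ^+ (n + s).-1.+1 * Z) =
    (h * pqnum p q n * p) *: (Y ^+ (n + s) * Z).
  case: n {IH} => [|n]; first by rewrite pqnum0 mulr0 mul0r !scale0r.
  by rewrite addSn.
by rewrite -scalerDl pqnumS; congr (_ *: _); ring.
Qed.

(** What a letters Y and b letters X become, up to a scalar, when k pairs XY are replaced by Y^s Z: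
    each replacement consumes one X and changes the exponent of Y by s - 1. *)
Definition normal (a b k : nat) : A :=
  Y ^+ avail s a k * Z ^+ k * X ^+ (b - k).

(** Either X passes all of Y^n Z^k or it is consumed with one Y. By the bound on c, n =
    [avail s c k] is not truncated, so that [(n + s).-1] is [avail s c k.+1]. *)
Lemma normalX c b k : (k <= b)%N -> (k <= c + s * k)%N ->
  X * normal c b k = (p ^+ k * q ^+ avail s c k) *: normal c b.+1 k +
    (h * pqnum p q (avail s c k)) *: normal c b.+1 k.+1.
Proof.
move=> lekb lekc; rewrite /normal !mulrA mulXYn mulrDl -!scalerAl.
rewrite -[_ * X * _]mulrA mulXZn mulrDl -!scalerAl -!scalerAr -!scalerAl
  scalerA.
rewrite -!mulrA -!exprS subSS -subSn // [q ^+ _ * _]mulrC;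
  congr (_ + _ *: (_ ^+ _ * _)).
  by rewrite /avail mulnS; lia.
by rewrite mulrA -exprS.
Qed.

(** Induction on the leading factor Y^(a-c) X: the remaining word has c letters Y and is normally
    ordered first, X acts on it by [normalX], and Y^(a-c) replaces c by a. *)
Lemma word_normal a lam : path geq a lam ->
  word X Y a lam =
  \sum_(0 <= k < (size lam).+1) (h ^+ k * wt s p q lam k) *: normal a (size
    lam) k.
Proof.
elim: lam a => [|c lam IH] a /=.
  by rewrite big_nat1 /normal /avail muln0 addn0 subn0 mul1r scale1r !mulr1.
move=> /andP[/= lec pl]; rewrite (IH c) // -mulrA.
(* Regrouping by the terms of the shorter word: index k feeds both k and k + 1. The unmatched terms
   at the two ends vanish, one of them by [wt_gt_size]. *)
have -> : \sum_(0 <= k < (size lam).+2)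
    (h ^+ k * step s p q (wt s p q lam) c k) *: normal a (size lam).+1 k =
  \sum_(0 <= k < (size lam).+1) (h ^+ k * wt s p q lam k) *: (
     (p ^+ k * q ^+ avail s c k) *: normal a (size lam).+1 k +
     (h * pqnum p q (avail s c k)) *: normal a (size lam).+1 k.+1).
  rewrite [RHS](eq_bigr _ (fun k _ => scalerDr _ _ _)) big_split /=.
  rewrite [in LHS](eq_bigr _ (fun k _ => etrans (congr1 (fun x =>
    x *: _) (mulrDr _ _ _)) (scalerDl _ _ _))).
  rewrite big_split /=; congr (_ + _).
    rewrite big_nat_recr //= wt_gt_size // !mulr0 scale0r addr0.
    by apply: eq_bigr => k _; rewrite scalerA; congr (_ *: _); ring.
  rewrite big_nat_recl //= mulr0 scale0r add0r.
  by apply: eq_bigr => k _; rewrite scalerA exprS; congr (_ *: _); ring.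
rewrite !mulr_sumr; apply: eq_big_nat => k; rewrite ltnS => /= lek.
rewrite -!scalerAr.
(* Here the exponent of Y would be truncated, but then the weight is 0. *)
have [ltc|gec] := ltnP (c + s * k) k.
  by rewrite (wt_gt_avail _ _ pl ltc) mulr0 !scale0r.
rewrite normalX // mulrDr -!scalerAr.
(* The exponent for k + 1 may still be truncated, but then [avail s c k] is 0 and the coefficient
   contains [0]. *)
have wtE j : (h * pqnum p q (avail s c k)) *: (Y ^+ (a - c) * normal c j k.+1) =
     (h * pqnum p q (avail s c k)) *: normal a j k.+1.
  case e : (avail s c k) => [|n]; first by rewrite pqnum0 mulr0 !scale0r.
  rewrite /normal !mulrA -exprD; congr (_ *: (_ ^+ _ * _ * _)).
  by move: e; rewrite /avail mulnS; lia.
rewrite wtE; congr (_ *: (_ *: _ + _)).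
rewrite /normal !mulrA -exprD; congr (_ ^+ _ * _ * _).
by rewrite /avail; lia.
Qed.

End NormalOrder.

Lemma normal_ordering (K : fieldType) s (h p q : K) (A : algType K) (X Y Z : A)
    m :
  pq_relations s h p q X Y Z ->
  (X + Y) ^+ m = \sum_(0 <= l < m.+1) \sum_(0 <= k < l.+1)
    \sum_(lam in Iab (m - l) l) (h ^+ k * wt s p q (heights lam) k) *:
         (Y ^+ (m - l + s * k - k) * Z ^+ k * X ^+ (l - k)).
Proof.
move=> XYZ; rewrite exprDwords; apply: eq_bigr => l _.
rewrite exchange_big /= (big_parts _ _ (fun lam => \sum_(0 <= k < l.+1)
  (h ^+ k * wt s p q lam k) *: (Y ^+ (m - l + s * k - k) * Z ^+ k * X ^+ (l -
    k)))).
apply: eq_big_seq => lam; rewrite mem_parts => /andP[/eqP szl pl].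
by rewrite (word_normal XYZ pl) szl.
Qed.

(** * Row creation rook placements *)

Section ColumnWeight.
Variables (K : fieldType) (p q : K) (T : eqType).
Implicit Types (U col : seq T) (r : option T).

(** [U] holds the rows of the rooks to the right. Rook boxes and cancelled boxes have weight 1; p
    marks a t-box if the column has a rook and an l-box if it has none; q marks an e-box. For s = 0,
    p marks the p-boxes and q the q-boxes. *)
Definition cellwt U col r (w : T) : K :=
  if r is Some x then
    if (w == x) || (w \in U) then 1
    else if (index w col < index x col)%N then p else q
  else if w \in U then p else q.

Definition colwt U col r : K := \prod_(w <- col) cellwt U col r w.

Lemma count_mem_sub U col :
  uniq U -> uniq col -> {subset U <= col} -> count (mem U) col = size U.
Proof.
move=> uU uC sUC; rewrite -size_filter; apply/perm_size/uniq_perm => //.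
  exact: filter_uniq.
by move=> w; rewrite mem_filter /=; case: (boolP (w \in U)) => // /sUC.
Qed.

Lemma count_notin_sub U col :
  uniq U -> uniq col -> {subset U <= col} ->
  count (fun w => w \notin U) col = (size col - size U)%N.
Proof.
move=> uU uC sUC; rewrite -(count_predC (mem U) col) count_mem_sub //.
by rewrite addKn; apply: eq_count.
Qed.

Lemma colwt_None U col : colwt U col None =
  p ^+ count (mem U) col * q ^+ count (fun w => w \notin U) col.
Proof.
rewrite /colwt /cellwt; elim: col => [|w col IH];
  first by rewrite big_nil mulr1.
rewrite big_cons IH /=; case: (w \in U) => /=; last by rewrite exprS mulrCA.
by rewrite exprS mulrA.
Qed.

(** Induction from the top. A new top row outside [U] puts one more box above each lower rook, and a
    rook in it has only boxes of weight q or 1 below; this is [pqnumS]. A top row in [U] has weight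
    1 and admits no rook. *)
Lemma sum_colwt_Some U col : uniq col ->
  \sum_(x <- col | x \notin U) colwt U col (Some x) =
  pqnum p q (count (fun w => w \notin U) col).
Proof.
elim: col => [|y col IH] /=; first by rewrite big_nil pqnum0.
case/andP=> yC uC; rewrite big_cons.
have tailE x : x \in col -> colwt U (y :: col) (Some x) =
    (if y \in U then 1 else p) * colwt U col (Some x).
  move=> xC; have nyx : (y == x) = false by apply: contraNF yC => /eqP ->.
  rewrite /colwt big_cons; congr (_ * _).
    by rewrite /cellwt nyx /= eqxx nyx.
  apply: eq_big_seq => w wC; rewrite /cellwt /= nyx.
  by have -> : (y == w) = false by apply: contraNF yC => /eqP ->.
have -> : \sum_(x <- col | x \notin U) colwt U (y :: col) (Some x) =
    (if y \in U then 1 else p) * pqnum p q (count (fun w => w \notin U) col).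
  rewrite -IH // mulr_sumr !(big_seq_cond [pred x | x \notin U]).
  by apply: eq_bigr => x /andP[xC _]; apply: tailE.
case: (boolP (y \in U)) => yU /=; first by rewrite mul1r.
rewrite pqnumS addrC; congr (_ + _).
rewrite /colwt big_cons /cellwt eqxx /= mul1r.
rewrite (eq_big_seq (fun w => if w \in U then 1 else q)); last first.
  move=> w wC; have nwy : (w == y) = false by apply: contraNF yC => /eqP <-.
  by rewrite nwy eqxx.
elim: {IH tailE yC uC} col => [|w col IH]; first by rewrite big_nil.
by rewrite big_cons IH /=; case: (w \in U); rewrite /= ?mul1r // exprS.
Qed.

End ColumnWeight.

Section BoardWeight.
Variables (K : fieldType) (p q : K).
Implicit Types (phi : rooked_board) (U : seq row_label).

Definition addrook U (r : option row_label) := oapp (cons^~ U) U r.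

Fixpoint boardwt U phi : K :=
  if phi is (col, r) :: phi' then
    colwt p q U col r * boardwt (addrook U r) phi'
  else 1.

Definition used_at U phi c :=
  foldl (fun V (cr : seq row_label * option row_label) =>
    addrook V cr.2) U (take c phi).

Lemma mem_used_at U phi c w :
  reflect (w \in U \/ exists2 i, (i < minn c (size phi))%N & rook_of phi i =
    Some w)
          (w \in used_at U phi c).
Proof.
elim: phi U c => [|[col r] phi IH] U c.
  by rewrite /used_at /= minn0; apply: (iffP idP) => [|[|[]]]; first by left.
case: c => [|c].
  by rewrite /used_at /= min0n; apply: (iffP idP) => [|[|[]]]; first by left.
rewrite /used_at /= -/(used_at _ _ _); apply: (iffP (IH _ _)).
  case=> [|[i lti ei]].
    case: r => [x|] /=; last by left.
    rewrite inE => /orP[/eqP ->|]; last by left.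
    by right; exists 0%N => //; rewrite minnSS.
  by right; exists i.+1 => //; rewrite minnSS.
case=> [wU|[[|i]]].
- by left; case: r => [x|] //=; rewrite inE wU orbT.
- by rewrite /rook_of /= => _ ->; left; rewrite /= inE eqxx.
by rewrite minnSS => lti ei; right; exists i.
Qed.

Lemma boardwt_prod U phi : boardwt U phi =
  \prod_(0 <= c < size phi)
     colwt p q (used_at U phi c) (nth ([::], None) phi c).1 (rook_of phi c).
Proof.
elim: phi U => [|[col r] phi IH] U; first by rewrite big_geq.
by rewrite /= big_nat_recl //= IH.
Qed.

Definition boxwt phi x : K :=
  p ^+ (tbox phi x + lbox phi x) * q ^+ ebox phi x.

(** The box types quantify over all rooks of the board, but a box lies to the left of a rook iff its
    row is in [U], and otherwise only the rook of its own column matters. *)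
Lemma boxwt_cell phi c w : (c < size phi)%N ->
  boxwt phi (c, w) =
  cellwt p q (used_at [::] phi c) (nth ([::], None) phi c).1 (rook_of phi c) w.
Proof.
move=> ltc; set U := used_at _ _ _.
have leftP (i : 'I_(size phi)) : left_of (c, w) i -> w \in U.
  case/andP=> /= lti /eqP ei; apply/mem_used_at; right; exists i => //.
  by rewrite leq_min lti ltn_ord.
have leftE : w \in U -> exists i : 'I_(size phi), left_of (c, w) i.
  case/mem_used_at=> [|[j]] //; rewrite leq_min => /andP[ltj ltj'] ej.
  by exists (Ordinal ltj'); rewrite /left_of /= ltj ej eqxx.
have left_ne (i : 'I_(size phi)) : left_of (c, w) i -> (c == i) = false.
  by case/andP=> /= lti _; apply: gtn_eqF.
rewrite /boxwt /ebox; case er: (rook_of phi c) => [x|] /=.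
  have nl : lbox phi (c, w) = false.
    rewrite /lbox; apply/negP => /andP[_ /existsP[i /andP[li /forallP/(_
      (Ordinal ltc))]]].
    rewrite /in_column /= er eqxx /= implybF negbK => /eqP ei.
    by have := left_ne _ li; rewrite -ei eqxx.
  have rE : rook_box phi (c, w) = (w == x).
    by rewrite /rook_box /= er (inj_eq Some_inj) eq_sym.
  rewrite nl rE; case: (boolP (w == x)) => nwx /=.
    by rewrite /tbox rE nwx /= mulr1.
  case: (boolP (w \in U)) => wU /=.
    have [i li] := leftE wU.
    have -> : cancelled_box phi (c, w).
      rewrite /cancelled_box rE (negPf nwx) /=; apply/existsP; exists i;
        rewrite li /=.
      apply/existsP; exists (Ordinal ltc); rewrite /in_column /= er eqxx andbT.
      by rewrite -(inj_eq val_inj) /= left_ne.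
    have -> : tbox phi (c, w) = false.
      rewrite /tbox; apply/negP => /andP[_ /existsP[j /andP[/andP[/= /eqP ecj
        _]]]].
      move=> /forallP/(_ i); rewrite li implybF negbK => /eqP eij.
      by have := left_ne _ li; rewrite eij ecj eqxx.
    by rewrite mulr1.
  have nli (i : 'I_(size phi)) : left_of (c, w) i = false.
    by apply: contraNF wU; apply: leftP.
  have -> : cancelled_box phi (c, w) = false.
    by rewrite /cancelled_box; apply/negP => /andP[_ /existsP[j]]; rewrite nli.
  have -> : tbox phi (c, w) =
      (index w (nth ([::], None) phi c).1 < index x (nth ([::], None) phi
        c).1)%N.
    rewrite /tbox rE (negPf nwx) /=; apply/existsP/idP => [[j]|lti].
      by rewrite /above /= => /andP[/andP[/eqP <-]]; rewrite er.
    exists (Ordinal ltc); rewrite /above /= er eqxx lti /=.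
    by apply/forallP => j; rewrite nli implybT.
  by case: ifP => _; rewrite /= ?mulr1 ?mul1r.
have rE : rook_box phi (c, w) = false by rewrite /rook_box /= er.
have nin (i : 'I_(size phi)) : in_column (c, w) i = false.
  by rewrite /in_column /=; case: eqP => // <-; rewrite er.
have -> : tbox phi (c, w) = false.
  rewrite /tbox; apply/negP => /andP[_ /existsP[j]].
  by rewrite /above /=; case: eqP => //= <-; rewrite er.
have -> : cancelled_box phi (c, w) = false.
  rewrite /cancelled_box;
    apply/negP => /andP[_ /existsP[i /andP[_ /existsP[j]]]].
  by rewrite nin andbF.
have -> : lbox phi (c, w) = (w \in U).
  rewrite /lbox rE /=; apply/existsP/idP => [[i /andP[/leftP]]//|/leftE[i li]].
  by exists i; rewrite li; apply/forallP => j; rewrite nin implybT.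
by rewrite rE; case: (w \in U); rewrite /= ?mulr1 ?mul1r.
Qed.

Lemma boardwtE phi :
  p ^+ (count (tbox phi) (boxes phi) + count (lbox phi) (boxes phi)) *
  q ^+ count (ebox phi) (boxes phi) = boardwt [::] phi.
Proof.
transitivity (\prod_(x <- boxes phi) boxwt phi x).
  rewrite /boxwt; elim: (boxes phi) => [|x l IH] /=;
    first by rewrite big_nil mulr1.
  by rewrite big_cons -IH mulrACA -!exprD addnACA.
rewrite boardwt_prod /boxes big_allpairs_dep /index_iota subn0.
apply: eq_big_seq => c; rewrite mem_iota => /= ltc.
by apply: eq_bigr => w _; apply: boxwt_cell.
Qed.

End BoardWeight.

Section Subdivision.
Variable s : nat.

Lemma subdivide_cat x c1 c2 :
  subdivide s x (c1 ++ c2) = subdivide s x c1 ++ subdivide s x c2.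
Proof. by rewrite /subdivide map_cat flatten_cat. Qed.

Lemma subdivide_id x col : x \notin col -> subdivide s x col = col.
Proof.
elim: col => [|y col IH] //; rewrite inE negb_or => /andP[nxy xC].
by rewrite -cat1s subdivide_cat IH // /subdivide /= eq_sym (negPf nxy).
Qed.

Lemma perm_subdivide x col : x \in col -> uniq col ->
  perm_eq (subdivide s x col) ([seq rcons x i | i <- iota 1 s] ++ col).
Proof.
case/splitPr=> pre post;
  rewrite cat_uniq /= negb_or => /and3P[_ /andP[xpre _] /andP[xpost _]].
rewrite subdivide_cat -[x :: post]cat1s subdivide_cat (subdivide_id xpre)
  (subdivide_id xpost).
rewrite /subdivide /= eqxx cats0 perm_sym perm_catCA.
by rewrite perm_cat2l perm_catC /= perm_cons perm_catC.
Qed.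

Definition ground (c : nat) : seq row_label := [seq [:: i] | i <- iota 0 c].

Definition subdivided (U : seq row_label) (c : nat) := foldr (subdivide s)
    (ground c) U.

(** Subdivision acts on each row separately, so a column remains the top part of any taller one.
    Hence a row of a column is present in all columns to its left. *)
Lemma subdivided_prefix U c d :
  exists e, subdivided U (c + d) = subdivided U c ++ e.
Proof.
elim: U => [|x U [e IH]];
  first by rewrite /subdivided /= /ground iotaD map_cat; eexists.
by exists (subdivide s x e);
  rewrite /subdivided /= -!/(subdivided _ _) IH subdivide_cat.
Qed.

(* The last clause makes the rows created by subdividing an unused row new. *)
Definition valid_column (U : seq row_label) (col : seq row_label) : Prop :=
  [/\ uniq col, {subset U <= col}, [::] \notin col &
      forall w i, w != [::] -> rcons w i \in col -> w \in U].

Lemma valid_ground c : valid_column [::] (ground c).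
Proof.
split=> //.
- by rewrite map_inj_uniq ?iota_uniq // => i j [].
- by apply/mapP => -[].
by move=> w i nw /mapP[j _]; case: w nw => [|a [|b w]].
Qed.

(** A created label [rcons x i] already present would put x into [U] by the last clause, which
    applies because x is nonempty. So the labels stay distinct. *)
Lemma valid_subdivide U col x : valid_column U col -> x \in col -> x \notin U ->
  valid_column (x :: U) (subdivide s x col).
Proof.
case=> uC sUC nC desc xC xU; have eP := perm_subdivide xC uC.
have nx : x != [::] by apply: contraNneq nC => <-.
have rI : injective (rcons x) by move=> i j /rcons_inj[].
split.
- rewrite (perm_uniq eP) cat_uniq uC map_inj_uniq // iota_uniq andbT /=.
  apply/hasPn => w wC; apply: contra xU => /mapP[i _ ew].
  by apply: (desc x i) => //; rewrite -ew.
- move=> w; rewrite (perm_mem eP) mem_cat inE => /orP[/eqP ->|/sUC ->];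
  rewrite ?xC orbT //.
- rewrite (perm_mem eP) mem_cat negb_or nC andbT.
  by apply/mapP => -[i _]; case: (x).
move=> w i nw; rewrite (perm_mem eP) mem_cat inE =>
  /orP[/mapP[j _ /rcons_inj[-> _]]|].
  by rewrite eqxx.
by move/desc => -> //; rewrite orbT.
Qed.

Variables (K : fieldType) (p q : K).

(** Whatever rows were used before, a column of height c has c + s u - u available rows, where u is
    the size of [U]. So the total weight of its choices depends only on the number of rooks already
    placed. *)
Lemma sum_placements U cs k :
  uniq U -> sorted leq cs ->
  {in cs, forall c, valid_column U (subdivided U c) /\
                    size (subdivided U c) = (c + s * size U)%N} ->
  \sum_(phi <- placements s U (map ground cs) | nrooks phi == k) boardwt p q U
    phi =
  fwd s p q (size U) cs k.
Proof.
elim: cs U k => [|c cs IH] U k uU srt val.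
  by rewrite /= big_mkcond big_seq1 /nrooks /= eq_sym; case: eqP.
have [[uC sUC nC desc] szC] := val c (mem_head _ _).
rewrite /= -/(subdivided U c) big_cat big_map [X in _ + X = _]big_mkcond /=.
rewrite big_allpairs_dep /=; congr (_ + _).
  rewrite -IH //; first 1 last.
  - exact: path_sorted srt.
  - by move=> c' c'in; apply: val; rewrite inE c'in orbT.
  by rewrite mulr_sumr; apply: eq_bigr => phi _;
    rewrite colwt_None count_mem_sub // count_notin_sub // szC.
case: k => [|k].
  by rewrite big1 // => x _; rewrite big1.
have -> : avail s c (size U) = count (fun w => w \notin U) (subdivided U c).
  by rewrite count_notin_sub // szC.
rewrite -sum_colwt_Some // big_filter mulr_suml.
rewrite !(big_seq_cond (fun x => x \notin U)); apply: eq_bigr => x /andP[xC xU].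
rewrite -(IH (x :: U)) /= ?xU //; first 1 last.
- exact: path_sorted srt.
- move=> c' c'in; have [vC' szC'] := val c' (mem_behead (s := c :: cs) c'in).
  (* The columns still to come are at least as tall, so they contain the row x and are subdivided
     there. *)
  have lec : (c <= c')%N.
    by apply: (allP (order_path_min leq_trans srt)).
  have xC' : x \in subdivided U c'.
    have [e] := subdivided_prefix U c (c' - c); rewrite subnKC // => ->.
    by rewrite mem_cat xC.
  split; first exact: valid_subdivide.
  case: vC' => uC' _ _ _.
  by rewrite /subdivided /= (perm_size (perm_subdivide xC' uC')) size_cat
    size_map
       size_iota szC' mulnS addnCA.
by rewrite -big_mkcond mulr_sumr.
Qed.

Lemma filter_ltn_iota n m : (n <= m)%N -> [seq i <- iota 0 m | (i < n)%N] =
    iota 0 n.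
Proof.
move=> lenm; rewrite -(subnKC lenm) iotaD filter_cat -[RHS]cats0;
  congr (_ ++ _).
  by apply/all_filterP/allP => i; rewrite mem_iota.
apply/eqP; rewrite -[_ == _]negbK -has_filter; apply/hasPn => i.
by rewrite mem_iota -leqNgt => /andP[].
Qed.

Lemma columns_ferrers a b (lam : {ffun 'I_b -> 'I_a.+1}) :
  columns (ferrers lam) = map ground (rev (heights lam)).
Proof.
rewrite /columns /heights -map_rev -map_comp; apply: eq_map => c /=.
rewrite /ground (map_comp (fun i : nat => [:: i]) val); congr map.
rewrite (eq_filter (a2 := preim val (fun i => (i < lam c)%N)));
  last by move=> r; rewrite inE.
rewrite -filter_map val_enum_ord.
by rewrite filter_ltn_iota // -ltnS ltn_ord.
Qed.

Lemma rook_pos_wt a b (lam : {ffun 'I_b -> 'I_a.+1}) k : lam \in Iab a b ->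
  rook_pos s 1 p q (ferrers lam) k = wt s p q (heights lam) k.
Proof.
rewrite path_heights => pl; rewrite /rook_pos expr1n mul1r columns_ferrers.
rewrite (eq_bigr _ (fun phi _ => boardwtE p q phi)) wt_fwd.
apply: (@sum_placements [::]) => //.
  by rewrite rev_sorted; apply: path_sorted pl.
move=> c _; split; first exact: valid_ground.
by rewrite /subdivided /= size_map size_iota muln0 addn0.
Qed.

End Subdivision.

(** * Non-attacking rook placements *)

Lemma sum_option (V : nmodType) (T : finType) (P : pred (option T)) (F : option
    T -> V) :
  \sum_(x | P x) F x =
  (if P None then F None else 0) + \sum_(x : T | P (Some x)) F (Some x).
Proof.
rewrite big_mkcond (bigD1 None) //=; congr (_ + _).
rewrite [RHS]big_mkcond (reindex_omap Some id) /=; last by case.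
by apply: eq_bigl => x; rewrite eqxx.
Qed.

Section NonattackingWeight.
Variables (K : fieldType) (p q : K) (a : nat).
Implicit Types (gs : seq nat) (l : seq (option 'I_a)).

Definition top_rows (c : nat) : seq 'I_a := [seq r : 'I_a <- enum 'I_a | (r <
    c)%N].

Lemma mem_top_rows c r : (r \in top_rows c) = (r < c)%N.
Proof. by rewrite mem_filter mem_enum andbT. Qed.

Lemma top_rows_uniq c : uniq (top_rows c).
Proof. by rewrite filter_uniq ?enum_uniq. Qed.

Lemma val_top_rows c : (c <= a)%N -> map val (top_rows c) = iota 0 c.
Proof.
by move=> leca; rewrite -(filter_map val (fun i =>
  i < c)%N) val_enum_ord filter_ltn_iota.
Qed.

Lemma size_top_rows c : (c <= a)%N -> size (top_rows c) = c.
Proof. by move=> leca; rewrite -(size_map val) val_top_rows // size_iota. Qed.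

Lemma index_top_rows c (r : 'I_a) : (c <= a)%N -> (r < c)%N -> index r
    (top_rows c) = r.
Proof.
move=> leca ltrc; rewrite -(index_map val_inj) val_top_rows //.
by rewrite -[X in index X _](nth_iota 0%N 0 ltrc) index_uniq ?size_iota
  ?iota_uniq.
Qed.

(** A placement lists, from left to right, the row of the rook of each column, with [None] for an
    empty column; two rooks thus never share a column. *)
Fixpoint fits gs l : bool :=
  match gs, l with
  | c :: gs', o :: l' =>
      (if o is Some r then (r < c)%N && (o \notin l') else true) && fits gs' l'
  | _, _ => true
  end.

Lemma fitsP gs l : size gs = size l ->
  reflect ((forall i r, nth None l i = Some r -> (r < nth 0%N gs i)%N) /\
           (forall i j r, nth None l i = Some r -> nth None l j = Some r -> i =
             j))
          (fits gs l).
Proof.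
elim: gs l => [|c gs IH] [|o l] //= => [_|[szl]].
  by apply: ReflectT; split=> i; rewrite nth_nil.
apply: (iffP andP) => [[oP /(IH _ szl)[lt_gs inj_l]]|[lt_gs inj_l]].
  have no r : o = Some r -> forall i, nth None l i <> Some r.
    move=> eo i ei; move: oP; rewrite eo => /andP[_ /negP]; apply.
    by rewrite -ei mem_nth // ltnNge; apply/negP => /(nth_default None);
      rewrite ei.
  split=> [[|i] r|[|i] [|j] r] //=.
  - by move=> eo; move: oP; rewrite eo => /andP[].
  - exact: lt_gs.
  - by move=> /no ne /ne.
  - by move=> ei /no/(_ i).
  - by move=> ei ej; rewrite (inj_l i j r).
split; last first.
  apply/(IH _ szl); split=> [i|i j r ei ej]; first exact: (lt_gs i.+1).
  by have [] := inj_l i.+1 j.+1 r ei ej.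
case: o lt_gs inj_l => [r|] // lt_gs inj_l; rewrite (lt_gs 0%N) //=.
apply/negP => /(nthP None)[i _ ei].
by have := inj_l 0%N i.+1 r erefl ei.
Qed.

Fixpoint rowswt gs l : K :=
  match gs, l with
  | c :: gs', o :: l' =>
      colwt p q (pmap id l') (top_rows c) o * rowswt gs' l'
  | _, _ => 1
  end.

Lemma mem_pmap_id l r : (r \in pmap id l) = (Some r \in l).
Proof. by rewrite mem_pmap map_id. Qed.

Lemma size_pmap_id l : size (pmap id l) = count isSome l.
Proof. exact: size_pmap. Qed.

Lemma rowswt_prod gs l : size gs = size l ->
  rowswt gs l = \prod_(0 <= c < size l)
    colwt p q (pmap id (drop c.+1 l)) (top_rows (nth 0%N gs c)) (nth None l c).
Proof.
elim: gs l => [|c gs IH] [|o l] //= => [_|[szl]]; first by rewrite big_geq.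
by rewrite big_nat_recl //= drop0 IH.
Qed.

(** The heights decrease weakly, so the row of a rook further right also meets a column of height c.
    This is what allows the taken rows to be counted. *)
Lemma fits_rooks c gs l : path geq c gs -> size gs = size l -> fits gs l ->
  uniq (pmap id l) /\ {subset pmap id l <= top_rows c}.
Proof.
elim: gs l c => [|c' gs IH] [|o l] c //= /andP[lec pl] [szl] /andP[oP fl].
have [uU sU] := IH _ _ pl szl fl.
have sU' : {subset pmap id l <= top_rows c}.
  by move=> r /sU; rewrite !mem_top_rows => /leq_trans; apply.
case: o oP => [r|] //= /andP[ltr rl]; rewrite mem_pmap_id rl uU; split=> // x.
by rewrite inE => /orP[/eqP ->|/sU'//]; rewrite mem_top_rows (leq_trans ltr).
Qed.

(** Induction on the leftmost column, as in [wt]: k rooks to its right take k of its c rows, and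
    without row creation c - k remain, which is [avail] at s = 0. *)
Lemma sum_rowswt b gs k : size gs = b -> path geq a gs ->
  \sum_(f : {ffun 'I_b -> option 'I_a} |
          fits gs [seq f i | i <- enum 'I_b] &&
          (count isSome [seq f i | i <- enum 'I_b] == k))
     rowswt gs [seq f i | i <- enum 'I_b] = wt 0 p q gs k.
Proof.
elim: b gs k => [|b IH] [|c gs] k // => [_ _|[szg] /= /andP[leca pl]].
  rewrite enum_ord0 /= (eq_bigl (fun=> k == 0%N)) => [|f]; last exact: eq_sym.
  case: eqP => _ /=; last by rewrite big_pred0.
  by rewrite sumr_const card_ffun card_ord expn0.
pose P l := fits (c :: gs) l && (count isSome l == k).
pose W l := rowswt (c :: gs) l.
rewrite (eq_bigl (fun f : {ffun 'I_b.+1 -> option 'I_a} =>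
  P [seq f i | i <- enum 'I_b.+1])) //.
rewrite (eq_bigr (fun f : {ffun 'I_b.+1 -> option 'I_a} =>
  W [seq f i | i <- enum 'I_b.+1])) //.
rewrite (big_ffext ord0) enum_ordSl.
have lE (f : {ffun 'I_b -> option 'I_a}) x :
    [seq ffext ord0 f x i | i <- ord0 :: [seq lift ord0 i | i <- enum 'I_b]] =
    x :: [seq f i | i <- enum 'I_b].
  rewrite /= ffext_self -map_comp; congr (_ :: _).
  by apply: eq_map => i /=; rewrite ffext_lift.
under eq_bigr => f _.
  under eq_bigl do rewrite lE.
  under eq_bigr do rewrite lE.
  rewrite sum_option /P /W /=.
  over.
have pl' : path geq a gs.
  by case: gs pl {IH szg P W} => //= c' gs /andP[lec ->];
    rewrite andbT (leq_trans lec).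
have szE (f : {ffun 'I_b -> option 'I_a}) :
    size gs = size [seq f i | i <- enum 'I_b].
  by rewrite size_map size_enum_ord.
have countE (f : {ffun 'I_b -> option 'I_a}) :
    fits gs [seq f i | i <- enum 'I_b] ->
    count (fun w => w \notin pmap id [seq f i | i <- enum 'I_b]) (top_rows c) =
    avail 0 c (count isSome [seq f i | i <- enum 'I_b]).
  move=> fl; have [uU sU] := fits_rooks pl (szE f) fl.
  rewrite count_notin_sub ?top_rows_uniq // size_top_rows //.
  by rewrite /avail mul0n addn0 size_pmap_id.
(* The values [None] and [Some r] at the leftmost column give the two summands of [step]. *)
rewrite big_split /= /step; congr (_ + _).
  rewrite -big_mkcond -IH // mulr_sumr; apply: eq_bigr => f /andP[fl /eqP cnt].
  have [uU sU] := fits_rooks pl (szE f) fl.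
  rewrite colwt_None countE // count_mem_sub ?top_rows_uniq //.
  by rewrite size_pmap_id -[count _ _]add0n cnt.
case: k @P => [|k] P.
  by rewrite big1 // => f _; rewrite big_pred0 // => r; rewrite andbF.
rewrite -IH // mulr_sumr [RHS]big_mkcond; apply: eq_bigr => f _.
case: ifPn => [/andP[fl /eqP cnt]|nf]; last first.
  by rewrite big_pred0 // => r; rewrite add1n eqSS -andbA (negPf nf) andbF.
rewrite -cnt -countE // -sum_colwt_Some ?top_rows_uniq // mulr_suml
  big_filter_cond.
rewrite big_enum_cond /=; apply: eq_bigl => r.
by rewrite fl add1n cnt eqxx !andbT mem_pmap_id.
Qed.

End NonattackingWeight.

Section RookZero.
Variables (K : fieldType) (p q : K) (a b : nat) (lam : {ffun 'I_b -> 'I_a.+1}).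
Implicit Types (f : {ffun 'I_b -> option 'I_a}).

Definition graph_set f : {set 'I_b * 'I_a} := [set x | f x.1 == Some x.2].

Definition set_graph (phi : {set 'I_b * 'I_a}) : {ffun 'I_b -> option 'I_a} :=
  [ffun c => [pick r | (c, r) \in phi]].

Lemma graph_setK : cancel graph_set set_graph.
Proof.
move=> f; apply/ffunP => c; rewrite ffunE; case: pickP => [r|nr].
  by rewrite inE /= => /eqP.
by case e : (f c) => [r|] //; have := nr r; rewrite inE /= e eqxx.
Qed.

Lemma set_graphK phi : nonattacking phi -> graph_set (set_graph phi) = phi.
Proof.
move=> na; apply/setP => -[c r]; rewrite inE ffunE /=;
  case: pickP => [r' phi_r'|->//].
apply/eqP/idP => [[<-]//|phi_r]; congr Some; apply/eqP/negPn/negP => nr.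
have /forallP/(_ (c, r')) := na; rewrite phi_r' /= => /forallP/(_ (c, r)).
by rewrite phi_r /= xpair_eqE eqxx nr.
Qed.

Lemma nth_ffun f (c : 'I_b) : nth None [seq f i | i <- enum 'I_b] c = f c.
Proof. by rewrite (nth_map c) ?size_enum_ord // nth_ord_enum. Qed.

Lemma fits_graph f :
  fits (heights lam) [seq f i | i <- enum 'I_b] =
  (graph_set f \subset ferrers lam) && nonattacking (graph_set f).
Proof.
have szE : size (heights lam) = size [seq f i | i <- enum 'I_b].
  by rewrite size_heights size_map size_enum_ord.
have ltb i r : nth None [seq f i | i <- enum 'I_b] i = Some r -> (i < b)%N.
  move=> ei; rewrite ltnNge; apply/negP => lebi.
  by move: ei; rewrite nth_default // size_map size_enum_ord.
apply/(fitsP szE)/andP => [[lt_l inj_l]|[sub na]].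
  split.
    apply/subsetP => -[c r]; rewrite !inE /= => /eqP ec.
    by rewrite -nth_heights lt_l // nth_ffun.
  apply/forallP => -[c r]; apply/implyP; rewrite inE /= => /eqP ec.
  apply/forallP => -[c' r']; apply/implyP; rewrite inE /= => /eqP ec'.
  apply/implyP; rewrite xpair_eqE => ne.
  have nc : c != c'.
    by apply: contraNneq ne => ecc'; move: ec'; rewrite -ecc' ec => -[->];
      rewrite !eqxx.
  rewrite nc; apply: contraNneq nc => err; apply/eqP/val_inj.
  by apply: (inj_l _ _ r); rewrite nth_ffun // err.
split=> [i r ei|i j r ei ej].
  have lti := ltb _ _ ei; move: ei.
  rewrite (nth_ffun f (Ordinal lti)) (nth_heights lam (Ordinal lti)) => ei.
  by have /subsetP/(_ (Ordinal lti, r)) := sub; rewrite !inE /= ei eqxx; apply.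
have lti := ltb _ _ ei; have ltj := ltb _ _ ej; move: ei ej.
rewrite (nth_ffun f (Ordinal lti)) (nth_ffun f (Ordinal ltj)) => ei ej.
have /forallP/(_ (Ordinal lti, r)) := na; rewrite inE /= ei eqxx /=.
move=> /forallP/(_ (Ordinal ltj, r)); rewrite inE /= ej eqxx /=.
by rewrite xpair_eqE eqxx !andbT andbF implybF negbK => /eqP[].
Qed.

Lemma card_graph f : #|graph_set f| = count isSome [seq f i | i <- enum 'I_b].
Proof.
rewrite -sum1_card big_mkcond /=.
rewrite (eq_bigr (fun x => if f x.1 == Some x.2 then 1%N else 0%N)) => [|x _];
  last by rewrite inE.
rewrite -(pair_bigA _ (fun c r => if f c == Some r then 1%N else 0%N)) /=.
rewrite -sum1_count big_map big_enum_cond /= [RHS]big_mkcond;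
  apply: eq_bigr => c _.
case: (f c) => [r|] /=; last by rewrite big1.
rewrite (bigD1 r) //= eqxx big1 // => r' ne; case: eqP => // -[er].
by rewrite er eqxx in ne.
Qed.

(** Both sides are compared box by box. As for row creation, r being in [U] expresses that the box
    lies to the left of a rook. *)
Lemma rook_weight_graph f :
  let phi := graph_set f in
  nonattacking phi ->  phi \subset ferrers lam ->
  p ^+ #|[set x | pbox0 (ferrers lam) phi x]| *
  q ^+ #|[set x | qbox0 (ferrers lam) phi x]| =
  rowswt p q (heights lam) [seq f i | i <- enum 'I_b].
Proof.
move=> phi na sub.
have expE (z : K) (P : pred ('I_b * 'I_a)) : z ^+ #|[set x | P x]| = \prod_x z
    ^+ P x.
  rewrite -sum1_card expr_sum big_mkcond; apply: eq_bigr => x _.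
  by rewrite inE; case: (P x).
have szE : size (heights lam) = size [seq f i | i <- enum 'I_b].
  by rewrite size_heights size_map size_enum_ord.
rewrite !expE -big_split rowswt_prod // size_map size_enum_ord big_mkord.
rewrite (eq_bigr (fun x => p ^+ pbox0 (ferrers lam) phi (x.1, x.2) *
    q ^+ qbox0 (ferrers lam) phi (x.1, x.2))) => [|[] //].
rewrite -(pair_bigA _ (fun c r => p ^+ pbox0 (ferrers lam) phi (c, r) *
                                  q ^+ qbox0 (ferrers lam) phi (c, r))) /=.
apply: eq_bigr => c _;
  rewrite nth_ffun nth_heights /colwt big_filter big_enum_cond /=.
rewrite [RHS]big_mkcond; apply: eq_bigr => r _.
have -> : (r < lam c)%N = ((c, r) \in ferrers lam) by rewrite inE.
case: ifPn => Bcr; last by rewrite /pbox0 /qbox0 (negPf Bcr) mulr1.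
set U := pmap id _.
have leftP (y : 'I_b * 'I_a) : y \in phi -> cell_left (c, r) y -> r \in U.
  case: y => c' r'; rewrite inE /= => /eqP ec' /andP[/= ltc /eqP ->].
  rewrite mem_pmap_id; apply/(nthP None); exists (c' - c.+1)%N.
    by rewrite size_drop size_map size_enum_ord; have := ltn_ord c'; lia.
  by rewrite nth_drop subnKC // nth_ffun.
have leftE : r \in U -> exists2 y, y \in phi & cell_left (c, r) y.
  rewrite mem_pmap_id => /(nthP None)[j].
  rewrite size_drop size_map size_enum_ord => ltj; rewrite nth_drop.
  have ltb : (c.+1 + j < b)%N by lia.
  rewrite (nth_ffun f (Ordinal ltb)) => ej; exists (Ordinal ltb, r).
    by rewrite inE /= ej.
  by rewrite /cell_left /= eqxx andbT addSn ltnS leq_addr.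
have ltr : (r < lam c)%N by move: Bcr; rewrite inE.
have lec : (lam c <= a)%N by rewrite -ltnS.
have phiE r' : ((c, r') \in phi) = (f c == Some r') by rewrite inE.
have qE : qbox0 (ferrers lam) phi (c, r) =
    ((c, r) \notin phi) && ~~ [exists y in phi, cell_above (c, r) y ||
      cell_left (c, r) y].
  rewrite /qbox0 /cancelled_box0 Bcr /=; case: ((c, r) \in phi) => //=.
  case: [exists y in phi, _ || _] / boolP => [|/existsPn no] /=.
    by case: (pbox0 _ _ _).
  rewrite andbT /pbox0;
    apply/negP => /and3P[_ _ /existsP[y /and3P[y_phi xy _]]].
  by have := no y; rewrite y_phi xy.
case ec: (f c) => [x|] /=.
  have phi_x : (c, x) \in phi by rewrite phiE ec.
  rewrite qE /pbox0 Bcr phiE ec (inj_eq Some_inj) eq_sym /=.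
  case: (boolP (r == x)) => nrx /=; first by rewrite mulr1.
  case: (boolP (r \in U)) => rU /=.
    have [y y_phi ly] := leftE rU.
    have -> : [exists y in phi, cell_above (c, r) y || cell_left (c, r) y].
      by apply/existsP; exists y; rewrite y_phi ly orbT.
    (* The witness of a p-box would be both the rook of the column and the rook to the right, so the
       box is cancelled. *)
    case: existsP => [[y0 /and3P[_ _ /forallP only]]|_]; last by rewrite mulr1.
    have := only (c, x); rewrite phi_x eqxx andbF implybF negbK => /eqP ey0.
    have := only y; rewrite y_phi ly /= implybF negbK -ey0 => /eqP ey.
    by move: ly; rewrite ey /cell_left /= ltnn.
  have nleft y : y \in phi -> cell_left (c, r) y = false.
    by move=> y_phi; apply: contraNF rU; apply: leftP.
  have above y : y \in phi -> cell_above (c, r) y = (y == (c, x)) && (r < x)%N.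
    case: y => c' r' y_phi; rewrite /cell_above /= xpair_eqE [c == c']eq_sym.
    case: eqP => //= ecc; move: y_phi;
      rewrite ecc phiE ec (inj_eq Some_inj) => /eqP <-.
    by rewrite eqxx.
  rewrite !index_top_rows ?(fun H => subsetP sub _ H) //; last first.
    by have := subsetP sub _ phi_x; rewrite inE.
  case: (ltnP r x) => ltrx /=.
    have -> : [exists y in phi, cell_above (c, r) y || cell_left (c, r) y].
      by apply/existsP; exists (c, x); rewrite phi_x above // eqxx ltrx.
    suff -> : [exists y in phi, (cell_above (c, r) y || cell_left (c, r) y) &&
        [forall z in phi, (z != y) ==> ~~ cell_left (c, r) z && (c != z.1)]] by
          rewrite mulr1.
    apply/existsP; exists (c, x); rewrite phi_x above // eqxx ltrx /=.
    apply/forallP => -[c' r']; apply/implyP => z_phi; apply/implyP => nz.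
    rewrite nleft //=; apply: contraNneq nz => ecc; move: z_phi.
    by rewrite -ecc phiE ec => /eqP[->].
  have no y : y \in phi -> cell_above (c, r) y || cell_left (c, r) y = false.
    by move=> y_phi; rewrite above // nleft // ltnNge ltrx andbF.
  have -> : [exists y in phi, cell_above (c, r) y || cell_left (c, r) y] =
      false.
    by apply/existsP => -[y /andP[/no ->]].
  case: existsP => [[y /and3P[/no ->]]//|_]; by rewrite mul1r.
have nphi r' : (c, r') \in phi = false by rewrite phiE ec.
have nab y : y \in phi -> cell_above (c, r) y = false.
  by case: y => c' r' y_phi; rewrite /cell_above /=; case: eqP y_phi => //= <-;
    rewrite nphi.
rewrite qE /pbox0 Bcr nphi /=; case: (boolP (r \in U)) => rU.
  have [y y_phi ly] := leftE rU.
  have -> : [exists y in phi, cell_above (c, r) y || cell_left (c, r) y].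
    by apply/existsP; exists y; rewrite y_phi ly orbT.
  suff -> : [exists y in phi, (cell_above (c, r) y || cell_left (c, r) y) &&
      [forall z in phi, (z != y) ==> ~~ cell_left (c, r) z && (c != z.1)]] by
        rewrite mulr1.
  (* The rook y is the only one in its row, as rooks do not attack each other, and the column of the
     box has none. *)
  apply/existsP; exists y; rewrite y_phi ly orbT /=.
  apply/forallP => z; apply/implyP => z_phi; apply/implyP => nz; apply/andP;
    split.
    apply: contraNN nz => lz; apply/negPn/negP => nz.
    have /forallP/(_ z) := na; rewrite z_phi => /forallP/(_ y);
        rewrite y_phi nz /=.
    by case/andP: lz => _ /eqP <-; case/andP: ly => _ /eqP <-;
      rewrite eqxx andbF.
  by case: z z_phi {nz} => c' r' z_phi; apply: contraTneq z_phi => /= <-;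
    rewrite nphi.
have no y : y \in phi -> cell_above (c, r) y || cell_left (c, r) y = false.
  by move=> y_phi; rewrite nab //=; apply: contraNF rU; apply: leftP.
have -> : [exists y in phi, cell_above (c, r) y || cell_left (c, r) y] = false.
  by apply/existsP => -[y /andP[/no ->]].
case: existsP => [[y /and3P[/no ->]]//|_]; by rewrite mul1r.
Qed.

Lemma rook_zero_wt k : lam \in Iab a b ->
  rook_zero p q (ferrers lam) k = wt 0 p q (heights lam) k.
Proof.
rewrite path_heights => pl; rewrite -(@sum_rowswt _ p q a b) ?size_heights //.
rewrite /rook_zero (reindex_onto graph_set set_graph) => [|phi]; last first.
  by case/and3P=> _ na _; apply: set_graphK.
apply: eq_big => f.
  by rewrite graph_setK eqxx andbT fits_graph card_graph andbA.
by case/andP=> /and3P[sub na _] _; apply: rook_weight_graph.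
Qed.

End RookZero.

(** * Rook numbers and coefficients J in terms of the weight *)

Lemma rook1_wt (K : fieldType) s (p q : K) a b
    (lam : {ffun 'I_b -> 'I_a.+1}) k : lam \in Iab a b ->
  rook1 s p q (ferrers lam) k = wt s p q (heights lam) k.
Proof.
rewrite /rook1; case: eqP => [->|_]; first exact: rook_zero_wt.
exact: rook_pos_wt.
Qed.

Lemma rev_heights_rev_ord a b (lam : {ffun 'I_b -> 'I_a.+1}) :
  rev [seq val (lam (rev_ord j)) | j <- enum 'I_b] = heights lam.
Proof.
apply: (@eq_from_nth _ 0%N); rewrite size_rev size_map size_enum_ord.
  by rewrite size_heights.
move=> i ltib; rewrite (nth_heights lam (Ordinal ltib)).
rewrite nth_rev size_map size_enum_ord //.
pose j := rev_ord (Ordinal ltib).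
rewrite (nth_map j) ?size_enum_ord ?ltn_subrL ?(leq_ltn_trans _ ltib) //.
by rewrite -[(b - i.+1)%N]/(val j) nth_ord_enum rev_ordK.
Qed.

(** For l = 0 the bound forces k = 0, and the only sequence, the empty one, has weight 1, in
    agreement with the convention. Otherwise lambda is fixed first and [sum_bits] evaluates the sum
    over the bits. *)
Lemma jcoef_wt (K : fieldType) s (p q : K) m l k : (k <= l)%N ->
  jcoef s p q m l k = \sum_(lam in Iab (m - l) l) wt s p q (heights lam) k.
Proof.
rewrite /jcoef; case: eqP => [->|_ _].
  by rewrite leqn0 => /eqP ->;
    rewrite (big_parts _ _ (wt s p q ^~ 0%N)) big_seq1.
rewrite exchange_big /=; apply: eq_bigr => lam lamI.
under eq_bigr do rewrite jtermE //.
by rewrite sum_bits rev_heights_rev_ord.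
Qed.

Theorem corollary3p9 (R : realType) (s : nat) (h p q : R[i])
    (h_neq0 : h != 0) (p_neq1 : p != 1) (q_neq1 : q != 1)
    (m : nat) (m_gt0 : (0 < m)%N) :
  (forall l k : nat, (k <= l <= m)%N ->
     jcoef s p q m l k =
     \sum_(lam in Iab (m - l) l) rook1 s p q (ferrers lam) k) /\
  (forall (A : algType R[i]) (X Y Z : A), pq_relations s h p q X Y Z ->
     (X + Y) ^+ m =
     \sum_(0 <= l < m.+1) \sum_(0 <= k < l.+1) \sum_(lam in Iab (m - l) l)
       (h ^+ k * rook1 s p q (ferrers lam) k) *:
         (Y ^+ (m - l + s * k - k) * Z ^+ k * X ^+ (l - k))).
Proof.
split=> [l k /andP[lekl _]|A X Y Z XYZ].
  by rewrite jcoef_wt //; apply: eq_bigr => lam lamI; rewrite rook1_wt.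
rewrite (normal_ordering m XYZ); apply: eq_bigr => l _; apply: eq_bigr => k _.
by apply: eq_bigr => lam lamI; rewrite rook1_wt.
Qed.
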